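(* Let $T=\mathrm{diag}(t_1,t_2,t_3)$ be a real diagonal $3\times 3$ matrix with $t_1t_2t_3\neq 0$, and let $\boldsymbol v\in\mathbb{R}^3$ be any nonzero vector. Then \[ \int_{\{\boldsymbol n\in S^2:\ \boldsymbol n\cdot\boldsymbol v\geq 0\}} \frac{\boldsymbol n}{(\boldsymbol n^\intercal T^{-2}\boldsymbol n)^{2}}\,\mathrm{d}^2\boldsymbol n \;=\; \frac{\pi\,|\det T|\, T^2\boldsymbol v}{|T\boldsymbol v|}, \] where the integral is taken componentwise.
   Context: $S^2$ denotes the unit sphere in $\mathbb{R}^3$ and $\mathrm{d}^2\boldsymbol n$ is the standard surface (area) measure on $S^2$ (in spherical coordinates $\boldsymbol n=(\sin\theta\cos\phi,\sin\theta\sin\phi,\cos\theta)$, $\mathrm{d}^2\boldsymbol n=\sin\theta\,\mathrm{d}\theta\,\mathrm{d}\phi$). $|\cdot|$ is the Euclidean norm. *)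

(* Defs.v *)
From Stdlib Require Import Reals Lra.
Open Scope R_scope.

Fixpoint sumN (n : nat) (g : nat -> R) : R :=
  match n with O => 0 | S k => sumN k g + g k end.

Definition fine_partition (a b delta : R) (m : nat) (x : nat -> R) : Prop :=
  x O = a /\ x m = b /\
  forall i, (i < m)%nat -> x i <= x (S i) /\ x (S i) - x i < delta.

Definition is_RInt2 (f : R -> R -> R) (a b c d l : R) : Prop :=
  forall eps, 0 < eps -> exists delta, 0 < delta /\
    forall (m n : nat) (x y : nat -> R) (tx ty : nat -> nat -> R),
      fine_partition a b delta m x -> fine_partition c d delta n y ->
      (forall i j, (i < m)%nat -> (j < n)%nat ->
          x i <= tx i j <= x (S i) /\ y j <= ty i j <= y (S j)) ->
      Rabs (sumN m (fun i => sumN n (fun j =>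
              f (tx i j) (ty i j) * (x (S i) - x i) * (y (S j) - y j))) - l)
        < eps.

Definition dot3 (u w : nat -> R) : R := u 0%nat * w 0%nat + u 1%nat * w 1%nat + u 2%nat * w 2%nat.
Definition norm3 (u : nat -> R) : R := sqrt (dot3 u u).

Definition sph (theta phi : R) (k : nat) : R :=
  match k with
  | O => sin theta * cos phi
  | 1%nat => sin theta * sin phi
  | _ => cos theta
  end.

(* T = diag(t 0, t 1, t 2); n^T T^{-2} n *)
Definition quadTinv2 (t u : nat -> R) : R :=
  (u 0%nat / t 0%nat) ^ 2 + (u 1%nat / t 1%nat) ^ 2 + (u 2%nat / t 2%nat) ^ 2.

(* k-th component of the integrand over the hemisphere {n . v >= 0}, times the
   area element sin theta, as a function of (theta, phi) in [0,pi] x [0,2pi]. *)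
Definition hemi_integrand (t v : nat -> R) (k : nat) (theta phi : R) : R :=
  let n := sph theta phi in
  if Rle_dec 0 (dot3 n v) then n k / (quadTinv2 t n) ^ 2 * sin theta else 0.

Definition diagmul (t u : nat -> R) (k : nat) : R := t k * u k.

(* Main.v *)
Require Import Defs.
From Stdlib Require Import Reals Lra Lia Psatz.
From Coquelicot Require Import Coquelicot.
Open Scope R_scope.

(** Write [w] for the area element divided by [(n^T T^-2 n)^2]. The integral is the gradient
    in [v] of the convex function [G v], the integral of [max(n.v, 0) w]. As
    [1(z >= 0)] is a subgradient of [max(z, 0)], the [k]-th integrand lies between the
    difference quotients of [max(n.v, 0) w] along [-h e_k] and [h e_k], which are
    continuous; so both integrability and the value follow from
    [G v = PI |det T| |T v|] and the differentiability of the norm.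

    To compute [G]: its subgradient in the third coordinate [c] is elementary, since for a
    fixed azimuth [sin cos / (p sin^2 + q cos^2)^2] has the primitive
    [sin^2 / (2 q (p sin^2 + q cos^2))], which turns the outer integral into that of the
    inverse of a binary quadratic form. On the equator [c = 0] the positive part factors out of
    the inner integral, and the outer one has an algebraic primitive. *)

(** * Double Riemann sums *)

Lemma sumN_ext n f g : (forall i, (i < n)%nat -> f i = g i) -> sumN n f = sumN n g.
Proof.
  induction n as [|n IH]; intros H; simpl; [reflexivity|].
  rewrite IH, H by (intros; try apply H; lia). reflexivity.
Qed.

Lemma sumN_le n f g : (forall i, (i < n)%nat -> f i <= g i) -> sumN n f <= sumN n g.
Proof.
  induction n as [|n IH]; intros H; simpl; [lra|].
  apply Rplus_le_compat; [apply IH; intros; apply H; lia | apply H; lia].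
Qed.

Lemma sumN_lin n f g k : sumN n (fun i => k * (f i - g i)) = k * (sumN n f - sumN n g).
Proof. induction n as [|n IH]; simpl; [ring|]. rewrite IH; ring. Qed.

Lemma sumN_mult_r n f k : sumN n (fun i => f i * k) = sumN n f * k.
Proof. induction n as [|n IH]; simpl; [ring|]. rewrite IH; ring. Qed.

Lemma sumN_exchange m n f :
  sumN m (fun i => sumN n (fun j => f i j)) = sumN n (fun j => sumN m (fun i => f i j)).
Proof.
  induction m as [|m IH]; simpl.
  - induction n as [|n IHn]; simpl; [ring|]. rewrite <- IHn; ring.
  - rewrite IH. clear IH. induction n as [|n IHn]; simpl; [ring|].
    rewrite <- IHn; ring.
Qed.

Lemma fine_partition_mono a b delta m x : fine_partition a b delta m x ->
  forall i j, (i <= j <= m)%nat -> x i <= x j.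
Proof.
  intros (_ & _ & H) i j Hij. destruct Hij as [Hij Hj].
  induction Hij as [|j Hij IH]; [lra|].
  apply Rle_trans with (x j); [apply IH; lia | apply H; lia].
Qed.

Lemma fine_partition_bounds a b delta m x : fine_partition a b delta m x ->
  forall i, (i <= m)%nat -> a <= x i <= b.
Proof.
  intros H i Hi. pose proof (fine_partition_mono _ _ _ _ _ H) as M.
  destruct H as (<- & <- & _). split; apply M; lia.
Qed.

Lemma fine_partition_weaken a b d1 d2 m x : d1 <= d2 ->
  fine_partition a b d1 m x -> fine_partition a b d2 m x.
Proof.
  intros Hd (H0 & Hm & H). repeat split; try assumption; apply H in H1; lra.
Qed.

(** Shaped for difference quotients: [k] will be the inverse of a step, [f] and [g] the potential at
    two neighbouring vectors. *)
Lemma is_RInt2_lin f g a b c d lf lg k :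
  is_RInt2 f a b c d lf -> is_RInt2 g a b c d lg ->
  is_RInt2 (fun x y => k * (f x y - g x y)) a b c d (k * (lf - lg)).
Proof.
  intros Hf Hg eps Heps.
  pose proof (Rabs_pos k) as Hk.
  set (e := eps / (2 * (Rabs k + 1))).
  assert (He : 0 < e) by (apply Rdiv_lt_0_compat; lra).
  destruct (Hf e He) as (d1 & Hd1 & H1). destruct (Hg e He) as (d2 & Hd2 & H2).
  exists (Rmin d1 d2); split; [now apply Rmin_glb_lt|].
  intros m n x y tx ty Px Py Ht.
  specialize (H1 m n x y tx ty
    (fine_partition_weaken _ _ _ _ _ _ (Rmin_l _ _) Px)
    (fine_partition_weaken _ _ _ _ _ _ (Rmin_l _ _) Py) Ht).
  specialize (H2 m n x y tx ty
    (fine_partition_weaken _ _ _ _ _ _ (Rmin_r _ _) Px)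
    (fine_partition_weaken _ _ _ _ _ _ (Rmin_r _ _) Py) Ht).
  match type of H1 with Rabs (?s - _) < _ => set (S1 := s) in * end.
  match type of H2 with Rabs (?s - _) < _ => set (S2 := s) in * end.
  match goal with |- Rabs (?s - _) < _ => replace s with (k * (S1 - S2)) end.
  - replace (k * (S1 - S2) - k * (lf - lg)) with (k * ((S1 - lf) - (S2 - lg))) by ring.
    rewrite Rabs_mult.
    assert (Hlt : Rabs ((S1 - lf) - (S2 - lg)) < 2 * e).
    { pose proof (Rabs_triang (S1 - lf) (- (S2 - lg))) as T. rewrite Rabs_Ropp in T.
      unfold Rminus at 1. lra. }
    apply Rle_lt_trans with (Rabs k * (2 * e)).
    + apply Rmult_le_compat_l; lra.
    + replace eps with ((Rabs k + 1) * (2 * e)) by (unfold e; field; lra).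
      apply Rmult_lt_compat_r; lra.
  - unfold S1, S2. rewrite <- sumN_lin. apply sumN_ext; intros i _.
    rewrite <- sumN_lin. apply sumN_ext; intros j _. ring.
Qed.

(** The hemisphere integrand jumps along a great circle, so uniform continuity cannot make it
    integrable. Riemann sums over one tagged grid are monotone in the function, so bounds with
    integrals close to [l] give existence and value at once. *)
Lemma is_RInt2_squeeze f a b c d l :
  (forall eps, 0 < eps -> exists f1 f2 l1 l2,
     is_RInt2 f1 a b c d l1 /\ is_RInt2 f2 a b c d l2 /\
     l - eps < l1 /\ l2 < l + eps /\
     forall x y, a <= x <= b -> c <= y <= d -> f1 x y <= f x y <= f2 x y) ->
  is_RInt2 f a b c d l.
Proof.
  intros H eps Heps.
  destruct (H (eps / 2) ltac:(lra)) as (f1 & f2 & l1 & l2 & H1 & H2 & L1 & L2 & F).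
  destruct (H1 (eps / 2) ltac:(lra)) as (d1 & Hd1 & S1).
  destruct (H2 (eps / 2) ltac:(lra)) as (d2 & Hd2 & S2).
  exists (Rmin d1 d2); split; [now apply Rmin_glb_lt|].
  intros m n x y tx ty Px Py Ht.
  specialize (S1 m n x y tx ty
    (fine_partition_weaken _ _ _ _ _ _ (Rmin_l _ _) Px)
    (fine_partition_weaken _ _ _ _ _ _ (Rmin_l _ _) Py) Ht).
  specialize (S2 m n x y tx ty
    (fine_partition_weaken _ _ _ _ _ _ (Rmin_r _ _) Px)
    (fine_partition_weaken _ _ _ _ _ _ (Rmin_r _ _) Py) Ht).
  assert (B : forall i j, (i < m)%nat -> (j < n)%nat ->
    (a <= tx i j <= b /\ c <= ty i j <= d) /\ 0 <= x (S i) - x i /\ 0 <= y (S j) - y j).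
  { intros i j Hi Hj. destruct (Ht i j Hi Hj).
    pose proof (fine_partition_bounds _ _ _ _ _ Px i ltac:(lia)).
    pose proof (fine_partition_bounds _ _ _ _ _ Px (S i) ltac:(lia)).
    pose proof (fine_partition_bounds _ _ _ _ _ Py j ltac:(lia)).
    pose proof (fine_partition_bounds _ _ _ _ _ Py (S j) ltac:(lia)). lra. }
  apply Rabs_def2 in S1. apply Rabs_def2 in S2.
  apply Rabs_def1.
  - eapply Rle_lt_trans with (_ - l); [apply Rplus_le_compat_r|].
    + apply sumN_le; intros i Hi. apply sumN_le; intros j Hj.
      destruct (B i j Hi Hj) as ((? & ?) & ? & ?).
      apply Rmult_le_compat_r; [assumption|]. apply Rmult_le_compat_r; [assumption|].
      apply F; assumption.
    + lra.
  - eapply Rlt_le_trans with (_ - l); [|apply Rplus_le_compat_r].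
    2:{ apply sumN_le; intros i Hi. apply sumN_le; intros j Hj.
      destruct (B i j Hi Hj) as ((? & ?) & ? & ?).
      apply Rmult_le_compat_r; [assumption|]. apply Rmult_le_compat_r; [assumption|].
      apply F; assumption. }
    lra.
Qed.

Lemma ex_RInt_everywhere_continuous (F : R -> R) a b :
  (forall z, continuous F z) -> ex_RInt F a b.
Proof. intros H. apply (ex_RInt_continuous (V := R_CompleteNormedModule)). auto. Qed.

Lemma riemann_sum_close F c d delta n y g eta :
  (forall z, continuous F z) -> fine_partition c d delta n y ->
  (forall j, (j < n)%nat -> forall z, y j <= z <= y (S j) -> Rabs (g j - F z) <= eta) ->
  Rabs (sumN n (fun j => g j * (y (S j) - y j)) - RInt F c d) <= eta * (d - c).
Proof.
  intros CF P H.
  assert (X : forall k, (k <= n)%nat ->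
    Rabs (sumN k (fun j => g j * (y (S j) - y j)) - RInt F c (y k)) <= eta * (y k - c)).
  { induction k as [|k IH]; intros Hk.
    - simpl. destruct P as (-> & _). rewrite RInt_point. unfold zero; simpl.
      replace (0 - 0) with 0 by ring. rewrite Rabs_R0. lra.
    - specialize (IH ltac:(lia)). simpl.
      pose proof (fine_partition_mono _ _ _ _ _ P k (S k) ltac:(lia)) as M.
      rewrite <- (RInt_Chasles F c (y k) (y (S k))) by now apply ex_RInt_everywhere_continuous.
      unfold plus; simpl.
      assert (E : Rabs (g k * (y (S k) - y k) - RInt F (y k) (y (S k)))
                  <= (y (S k) - y k) * eta).
      { refine (norm_RInt_le_const (V := R_NormedModule) (fun z => g k - F z) (y k) (y (S k)) _ eta M _ _).
        - intros z Hz. apply H; [lia | exact Hz].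
        - replace (g k * (y (S k) - y k) - RInt F (y k) (y (S k)))
            with (minus (scal (y (S k) - y k) (g k)) (RInt F (y k) (y (S k))))
            by (unfold minus, plus, opp, scal; simpl; unfold mult; simpl; ring).
          apply (is_RInt_minus (V := R_NormedModule)).
          + apply (is_RInt_const (V := R_NormedModule)).
          + apply (RInt_correct (V := R_CompleteNormedModule)).
            now apply ex_RInt_everywhere_continuous. }
      match goal with |- Rabs (?s + ?t - (?u + ?v)) <= _ =>
        replace (s + t - (u + v)) with ((s - u) + (t - v)) by ring end.
      eapply Rle_trans; [apply Rabs_triang|]. lra. }
  specialize (X n (le_n n)). destruct P as (_ & E & _). rewrite E in X. exact X.
Qed.

Lemma continuous_slice1 f : (forall x y, continuity_2d_pt f x y) ->
  forall y x, continuous (fun x => f x y) x.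
Proof.
  intros H y x. apply continuity_pt_filterlim.
  intros e He. destruct (H x y (mkposreal e He)) as (dl & Hdl).
  exists dl; split; [apply dl|]. intros z (_ & Hz). apply Hdl; [exact Hz|].
  rewrite Rminus_diag, Rabs_R0. apply dl.
Qed.

Lemma continuous_RInt_slice f a b : a <= b -> (forall x y, continuity_2d_pt f x y) ->
  forall y, continuous (fun y => RInt (fun x => f x y) a b) y.
Proof.
  intros Hab H y. apply continuity_pt_filterlim.
  intros e He. set (e' := e / (b - a + 1)).
  assert (He' : 0 < e') by (apply Rdiv_lt_0_compat; lra).
  destruct (uniform_continuity_2d f a b (y - 1) (y + 1) (fun x y _ _ => H x y)
    (mkposreal _ He')) as (dl & Hdl).
  (* The bound [1] keeps [z] in the strip on which uniform continuity was taken. *)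
  exists (Rmin dl 1); split; [apply Rmin_glb_lt; [apply dl | lra]|].
  intros z (_ & Hz). simpl in Hz |- *. unfold R_dist in *.
  pose proof (Rmin_l dl 1). pose proof (Rmin_r dl 1).
  apply Rle_lt_trans with ((b - a) * e').
  - refine (norm_RInt_le_const (V := R_NormedModule) (fun x => f x z - f x y) a b _ e' Hab _ _).
    + intros x Hx. left. apply Hdl; try lra.
      * apply Rabs_lt_between in Hz; [lra].
      * rewrite Rminus_diag, Rabs_R0. apply dl.
    + apply (is_RInt_minus (V := R_NormedModule));
      apply (RInt_correct (V := R_CompleteNormedModule));
      apply ex_RInt_everywhere_continuous; intros; now apply continuous_slice1.
  - replace e with ((b - a + 1) * e') by (unfold e'; field; lra).
    apply Rmult_lt_compat_r; lra.
Qed.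

(** Each tag depends on both indices, so the double sum is not an iterated Riemann sum. Uniform
    continuity compares the value at a tag with that at any other point of its cell, and
    [riemann_sum_close] then applies in each variable. *)
Lemma is_RInt2_continuous f a b c d : a <= b -> c <= d ->
  (forall x y, continuity_2d_pt f x y) ->
  is_RInt2 f a b c d (RInt (fun y => RInt (fun x => f x y) a b) c d).
Proof.
  intros Hab Hcd H eps Heps.
  (* The [+ 1] keeps the denominator positive on a degenerate rectangle and makes the last
     inequality strict. *)
  set (e := eps / ((b - a) * (d - c) + 1)).
  assert (Hp : 0 <= (b - a) * (d - c)) by (apply Rmult_le_pos; lra).
  assert (He : 0 < e) by (apply Rdiv_lt_0_compat; lra).
  destruct (uniform_continuity_2d f a b c d (fun x y _ _ => H x y) (mkposreal _ He))
    as (dl & Hdl).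
  exists dl; split; [apply dl|].
  intros m n x y tx ty Px Py Ht.
  rewrite sumN_exchange.
  rewrite (sumN_ext n _ (fun j => sumN m (fun i => f (tx i j) (ty i j) * (x (S i) - x i))
     * (y (S j) - y j))) by (intros; apply sumN_mult_r).
  apply Rle_lt_trans with (e * (b - a) * (d - c)).
  - apply riemann_sum_close with dl; [now apply continuous_RInt_slice | exact Py |].
    intros j Hj z Hz.
    apply (riemann_sum_close (fun x => f x z) a b dl m x (fun i => f (tx i j) (ty i j)));
      [now apply continuous_slice1 | exact Px |].
    intros i Hi w Hw.
    destruct (Ht i j Hi Hj).
    pose proof (fine_partition_bounds _ _ _ _ _ Px i ltac:(lia)).
    pose proof (fine_partition_bounds _ _ _ _ _ Px (S i) ltac:(lia)).
    pose proof (fine_partition_bounds _ _ _ _ _ Py j ltac:(lia)).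
    pose proof (fine_partition_bounds _ _ _ _ _ Py (S j) ltac:(lia)).
    destruct Px as (_ & _ & Px). specialize (Px i Hi).
    destruct Py as (_ & _ & Py). specialize (Py j Hj).
    left. apply Hdl; try lra; apply Rabs_def1; lra.
  - replace eps with (e * ((b - a) * (d - c) + 1)) by (unfold e; field; lra).
    rewrite Rmult_assoc. apply Rmult_lt_compat_l; lra.
Qed.

(** * Trigonometric integrals *)

Lemma is_RInt_antiderivative (F f : R -> R) a b : a <= b ->
  (forall x, is_derive F x (f x)) -> (forall x, continuous f x) ->
  is_RInt f a b (F b - F a).
Proof.
  intros Hab HF Hf. apply (is_RInt_derive (V := R_CompleteNormedModule) F f); auto.
Qed.

Lemma sin2_plus_cos2 x : sin x ^ 2 + cos x ^ 2 = 1.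
Proof. rewrite <- (sin2_cos2 x). unfold Rsqr. ring. Qed.

(** A rewriting rule: lowering the powers of the cosine brings trigonometric polynomials to a normal
    form that [ring] can compare. *)
Lemma cos_pow_SS x n : cos x ^ S (S n) = (1 - sin x ^ 2) * cos x ^ n.
Proof. rewrite <- (sin2_plus_cos2 x). simpl. ring. Qed.

Lemma quad_pos P Q x : 0 < P -> 0 < Q -> 0 < P * sin x ^ 2 + Q * cos x ^ 2.
Proof.
  intros HP HQ. pose proof (sin2_plus_cos2 x) as H.
  pose proof (pow2_ge_0 (sin x)). pose proof (pow2_ge_0 (cos x)).
  destruct (Rle_lt_dec (sin x ^ 2) 0).
  - assert (sin x ^ 2 = 0) as -> by lra. assert (cos x ^ 2 = 1) as -> by lra. lra.
  - apply Rplus_lt_le_0_compat; [now apply Rmult_lt_0_compat | apply Rmult_le_pos; lra].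
Qed.

(** * The inverse of a positive definite binary quadratic form *)

Section QuadraticForm.
Variables al be ga de : R.
Hypotheses (Hal : 0 < al) (Hde : 0 < de) (Hdet : de ^ 2 = al * ga - be ^ 2).

(** Let [A] be the symmetric matrix with diagonal [al], [ga] and off-diagonal entry [be], and
    [u = (cos x, sin x)]. Then [M x] and [N x] are the components of [A u] along [u] and along
    [(- sin x, cos x)]. *)
Let M x := al * cos x ^ 2 + 2 * be * cos x * sin x + ga * sin x ^ 2.
Let N x := be * (cos x ^ 2 - sin x ^ 2) + (ga - al) * (sin x * cos x).

Lemma form_pos x : 0 < M x.
Proof.
  unfold M. assert (H : 0 < al * (al * cos x ^ 2 + 2 * be * cos x * sin x + ga * sin x ^ 2)).
  { replace (al * _) with ((al * cos x + be * sin x) ^ 2 + de ^ 2 * sin x ^ 2)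
      by (rewrite Hdet; ring).
    pose proof (sin2_plus_cos2 x) as H.
    pose proof (pow2_ge_0 (al * cos x + be * sin x)).
    pose proof (pow2_ge_0 (sin x)).
    destruct (Rle_lt_dec (sin x ^ 2) 0).
    - assert (S : sin x ^ 2 = 0) by lra.
      assert (S' : sin x = 0) by nra. rewrite S'.
      assert (C : cos x ^ 2 = 1) by lra.
      replace ((al * cos x + be * 0) ^ 2) with (al ^ 2 * cos x ^ 2) by ring.
      rewrite C. nra.
    - assert (0 < de ^ 2 * sin x ^ 2) by (apply Rmult_lt_0_compat; nra). lra. }
  nra.
Qed.

(** The left side is the squared length of [(A + de) u], and Cayley-Hamilton gives
    [(A + de)^2 = (al + ga + 2 * de) A] because [de ^ 2] is the determinant of [A]. *)
Lemma form_identity x : N x ^ 2 + (M x + de) ^ 2 = (al + ga + 2 * de) * M x.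
Proof.
  assert (H : N x ^ 2 + M x ^ 2
    = (al + ga) * M x * (sin x ^ 2 + cos x ^ 2)
      - (al * ga - be ^ 2) * (sin x ^ 2 + cos x ^ 2) ^ 2) by (unfold N, M; ring).
  rewrite sin2_plus_cos2, <- Hdet in H.
  replace ((M x + de) ^ 2) with (M x ^ 2 + 2 * de * M x + de ^ 2) by ring. lra.
Qed.

Lemma is_derive_M x : is_derive M x (2 * N x).
Proof. unfold M, N. auto_derive; [trivial|]. ring. Qed.

Lemma is_derive_N x : is_derive N x (al + ga - 2 * M x).
Proof.
  unfold N. auto_derive; [trivial|].
  transitivity ((al + ga) * (sin x ^ 2 + cos x ^ 2) - 2 * M x).
  - unfold M; ring.
  - rewrite sin2_plus_cos2; ring.
Qed.

(* The symmetric square root [S] of the form is a multiple of form + [de]; this is the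
   argument of the vector [S (cos x, sin x)], which stays within [PI/2] of [x], so that no
   branch of the arctangent has to be changed. *)
Definition form_angle x := (x + atan (N x / (M x + de))) / de.

Lemma is_derive_form_angle x : is_derive form_angle x (/ M x).
Proof.
  unfold form_angle.
  pose proof (form_pos x) as HM. pose proof (is_derive_M x) as DM.
  pose proof (is_derive_N x) as DN. pose proof (form_identity x) as E.
  apply is_derive_ext with (fun x => (x + atan (N x / (M x + de))) / de); [reflexivity|].
  auto_derive.
  - repeat split; [now exists (al + ga - 2 * M x) | now exists (2 * N x) | lra].
  - change (Derive (fun x => N x) x) with (Derive N x).
    change (Derive (fun x => M x) x) with (Derive M x).
    rewrite (is_derive_unique _ _ _ DM), (is_derive_unique _ _ _ DN).
    clear DM DN.
    revert HM E. generalize (M x) (N x). intros m n Hm E.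
    assert (Hn : n ^ 2 = (al + ga + 2 * de) * m - (m + de) ^ 2) by lra.
    field_simplify_eq; [rewrite Hn; ring | repeat split; nra].
Qed.

(** [M] and [N] are homogeneous of degree two in [(cos x, sin x)], so they take the same values at
    [b] as at [0] and the arctangents cancel. *)
Lemma form_angle_period b : sin b = 0 -> form_angle b - form_angle 0 = b / de.
Proof.
  intros Hb. pose proof (sin2_plus_cos2 b) as H. rewrite Hb in H.
  assert (C : cos b ^ 2 = 1) by lra.
  unfold form_angle, N, M. rewrite Hb, C, sin_0, cos_0.
  replace (al * 1 + 2 * be * cos b * 0 + ga * 0 ^ 2 + de)
    with (al * 1 ^ 2 + 2 * be * 1 * 0 + ga * 0 ^ 2 + de) by ring.
  replace (be * (1 - 0 ^ 2) + (ga - al) * (0 * cos b))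
    with (be * (1 ^ 2 - 0 ^ 2) + (ga - al) * (0 * 1)) by ring.
  field. lra.
Qed.

Lemma is_RInt_inv_form b : 0 <= b -> sin b = 0 ->
  is_RInt (fun x => / M x) 0 b (b / de).
Proof.
  intros H Hb. rewrite <- form_angle_period by assumption.
  apply is_RInt_antiderivative; [assumption | apply is_derive_form_angle |].
  intros x. apply (ex_derive_continuous (V := R_NormedModule)).
  pose proof (form_pos x). unfold M in *. auto_derive. lra.
Qed.

End QuadraticForm.

(** * Integrals over a meridian and over the circle of azimuths *)

Lemma is_RInt_sin2_over_quad2 p q : 0 < p -> 0 < q ->
  is_RInt (fun x => sin x ^ 2 / (p * sin x ^ 2 + q * cos x ^ 2) ^ 2) 0 PI
    (PI / (2 * p * sqrt (p * q))).
Proof.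
  intros Hp Hq.
  assert (Hpq : 0 < p * q) by nra.
  assert (Hde : 0 < sqrt (p * q)) by now apply sqrt_lt_R0.
  assert (Hdet : sqrt (p * q) ^ 2 = q * p - 0 ^ 2) by (rewrite pow2_sqrt by lra; ring).
  set (de := sqrt (p * q)) in *.
  (* With [D] the form, [sin x * cos x / D] has derivative
     [(q * cos x ^ 2 - p * sin x ^ 2) / D ^ 2]; subtracted from [/ D], this leaves
     [2 * p * sin x ^ 2 / D ^ 2]. *)
  set (F x := (form_angle q 0 p de x
                - sin x * cos x / (p * sin x ^ 2 + q * cos x ^ 2)) / (2 * p)).
  replace (PI / (2 * p * de)) with (F PI - F 0).
  2:{ unfold F. rewrite sin_PI, cos_PI, sin_0, cos_0.
      transitivity ((form_angle q 0 p de PI - form_angle q 0 p de 0) / (2 * p)).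
      - field. split; lra.
      - rewrite (form_angle_period q 0 p de Hde PI sin_PI). field. lra. }
  apply is_RInt_antiderivative; [left; apply PI_RGT_0 | |].
  - intros x. pose proof (quad_pos p q x Hp Hq) as D.
    pose proof (is_derive_form_angle q 0 p de Hq Hde Hdet x) as A. cbv beta in A.
    unfold F. auto_derive.
    + repeat split; [eexists; exact A | lra].
    + change (Derive (fun x => form_angle q 0 p de x) x) with (Derive (form_angle q 0 p de) x).
      rewrite (is_derive_unique _ _ _ A).
      replace (q * cos x ^ 2 + 2 * 0 * cos x * sin x + p * sin x ^ 2)
        with (p * sin x ^ 2 + q * cos x ^ 2) by ring.
      field_simplify_eq; [|repeat split; lra].
      rewrite !cos_pow_SS. ring.
  - intros x. apply (ex_derive_continuous (V := R_NormedModule)).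
    pose proof (quad_pos p q x Hp Hq). auto_derive. nra.
Qed.

(** This writes [a * cos x + b * sin x] as [r * sin (x - x0)]. The values [a] and [- a] at [0] and
    [PI] force a zero [x0] in between, and [r] may have either sign or vanish. *)
Lemma polar_zero a b : exists r x0, 0 <= x0 <= PI /\ a = - r * sin x0 /\ b = r * cos x0.
Proof.
  pose proof PI_RGT_0.
  destruct (IVT_gen_consistent (fun x => a * cos x + b * sin x) 0 PI 0) as (x0 & H0 & E).
  - intros x. apply (ex_derive_continuous (V := R_NormedModule)). auto_derive. trivial.
  - rewrite cos_0, sin_0, cos_PI, sin_PI. unfold Rmin, Rmax.
    destruct (Rle_dec _ _); lra.
  - rewrite Rmin_left, Rmax_right in H0 by lra.
    (* As [(a, b)] is orthogonal to [(cos x0, sin x0)], it is determined by its coordinate [r] along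
       [(- sin x0, cos x0)]. *)
    exists (b * cos x0 - a * sin x0), x0. pose proof (sin2_plus_cos2 x0) as T.
    split; [exact H0|]. split.
    + transitivity (a * (sin x0 ^ 2 + cos x0 ^ 2) - cos x0 * (a * cos x0 + b * sin x0)).
      * rewrite T, E. ring.
      * ring.
    + transitivity (b * (sin x0 ^ 2 + cos x0 ^ 2) - sin x0 * (a * cos x0 + b * sin x0)).
      * rewrite T, E. ring.
      * ring.
Qed.

Lemma sin_diff_sign x x0 :
  (x0 < x < x0 + PI -> 0 < sin (x - x0)) /\ (x0 - PI < x < x0 -> sin (x - x0) < 0).
Proof.
  split; intros H.
  - apply sin_gt_0; lra.
  - replace (x - x0) with (- (x0 - x)) by ring. rewrite sin_neg.
    enough (0 < sin (x0 - x)) by lra. apply sin_gt_0; lra.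
Qed.

Lemma is_RInt_zero_ext (f : R -> R) a b : a <= b ->
  (forall x, a < x < b -> f x = 0) -> is_RInt f a b 0.
Proof.
  intros Hab H. apply is_RInt_ext with (fun _ => 0).
  - intros x. rewrite Rmin_left, Rmax_right by assumption. intros; symmetry; auto.
  - pose proof (is_RInt_const (V := R_NormedModule) a b 0) as C.
    change (scal (b - a) 0) with ((b - a) * 0) in C. now rewrite Rmult_0_r in C.
Qed.

Lemma is_RInt_cut (f : R -> R) a b c l1 l2 l :
  is_RInt f a b l1 -> is_RInt f b c l2 -> l = l1 + l2 -> is_RInt f a c l.
Proof. intros H1 H2 ->. exact (is_RInt_Chasles f a b c l1 l2 H1 H2). Qed.

(** The primitive [F] vanishes at both poles, so only its value at the cut [x0] remains. The sign of
    [r] decides which side of [x0] is kept; as [c = - r * sin x0] with [sin x0 >= 0], that sign is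
    recorded in [c * Rabs c]. *)
Lemma is_RInt_cap p q a c : 0 < p -> 0 < q ->
  is_RInt (fun x => if Rle_dec 0 (a * sin x + c * cos x)
                    then sin x * cos x / (p * sin x ^ 2 + q * cos x ^ 2) ^ 2 else 0)
    0 PI (c * Rabs c / (2 * q * (p * c ^ 2 + q * a ^ 2))).
Proof.
  intros Hp Hq. pose proof PI_RGT_0 as HPI.
  set (f x := if Rle_dec _ _ then _ else _).
  set (g x := sin x * cos x / (p * sin x ^ 2 + q * cos x ^ 2) ^ 2).
  set (F x := sin x ^ 2 / (2 * q * (p * sin x ^ 2 + q * cos x ^ 2))).
  assert (Hg : forall u v, u <= v -> is_RInt g u v (F v - F u)).
  { intros u v Huv. apply is_RInt_antiderivative; [exact Huv| |].
    - intros x. pose proof (quad_pos p q x Hp Hq). unfold F, g. auto_derive.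
      + nra.
      + field_simplify_eq; [|repeat split; lra].
        rewrite !cos_pow_SS. ring.
    - intros x. apply (ex_derive_continuous (V := R_NormedModule)).
      pose proof (quad_pos p q x Hp Hq). unfold g. auto_derive. nra. }
  assert (F0 : F 0 = 0) by (unfold F; rewrite sin_0; unfold Rdiv; ring).
  assert (FPI : F PI = 0) by (unfold F; rewrite sin_PI; unfold Rdiv; ring).
  destruct (polar_zero c a) as (r & x0 & Hx0 & Hc & Ha).
  assert (L : forall x, a * sin x + c * cos x = r * sin (x - x0))
    by (intros; rewrite sin_minus, Ha, Hc; ring).
  assert (Hs : 0 <= sin x0) by (apply sin_ge_0; lra).
  pose proof (quad_pos p q x0 Hp Hq) as D0.
  assert (on : forall u v, u <= v -> (forall x, u < x < v -> 0 <= r * sin (x - x0)) ->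
    is_RInt f u v (F v - F u)).
  { intros u v Huv H. apply is_RInt_ext with g; [|now apply Hg].
    rewrite Rmin_left, Rmax_right by assumption. intros x Hx. unfold f.
    destruct (Rle_dec _ _) as [_|n]; [reflexivity|]. rewrite L in n. now elim n; apply H. }
  assert (off : forall u v, u <= v -> (forall x, u < x < v -> r * sin (x - x0) < 0) ->
    is_RInt f u v 0).
  { intros u v Huv H. apply is_RInt_zero_ext; [assumption|]. intros x Hx. unfold f.
    destruct (Rle_dec _ _) as [n|_]; [|reflexivity]. rewrite L in n.
    specialize (H x Hx). lra. }
  assert (Hden : r <> 0 -> 0 < p * (- r * sin x0) ^ 2 + q * (r * cos x0) ^ 2).
  { intros Hr. replace (_ + _) with (r ^ 2 * (p * sin x0 ^ 2 + q * cos x0 ^ 2)) by ring.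
    apply Rmult_lt_0_compat; [|assumption]. rewrite <- Rsqr_pow2. now apply Rsqr_pos_lt. }
  destruct (Rtotal_order r 0) as [Hr|[Hr|Hr]].
  - apply is_RInt_cut with x0 (F x0 - F 0) 0.
    + apply on; [lra|]. intros x Hx.
      pose proof (proj2 (sin_diff_sign x x0) ltac:(lra)). nra.
    + apply off; [lra|]. intros x Hx.
      pose proof (proj1 (sin_diff_sign x x0) ltac:(lra)). nra.
    + rewrite F0, Ha, Hc. unfold F. rewrite Rabs_pos_eq by nra. specialize (Hden ltac:(lra)).
      field. repeat split; lra.
  (* Here [a] and [c] both vanish: the test [0 <= 0] keeps the whole meridian, whose integral is
     zero, and the stated value is [0 / 0 = 0]. *)
  - assert (c = 0) as -> by (rewrite Hc, Hr; ring).
    replace (0 * Rabs 0 / _) with (F PI - F 0) by (rewrite F0, FPI; unfold Rdiv; ring).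
    apply on; [lra|]. intros; rewrite Hr; lra.
  - apply is_RInt_cut with x0 0 (F PI - F x0).
    + apply off; [lra|]. intros x Hx.
      pose proof (proj2 (sin_diff_sign x x0) ltac:(lra)). nra.
    + apply on; [lra|]. intros x Hx.
      pose proof (proj1 (sin_diff_sign x x0) ltac:(lra)). nra.
    + rewrite FPI, Ha, Hc. unfold F. rewrite Rabs_left1 by nra. specialize (Hden ltac:(lra)).
      field. repeat split; lra.
Qed.

(** The positive part lives on a half circle bounded by [x0] and [x0 + PI], where [F] takes opposite
    values. For [r < 0] that half circle wraps around [0], and the periodicity of [F] joins its two
    arcs. *)
Lemma is_RInt_max_over_form P Q a b : 0 < P -> 0 < Q ->
  is_RInt (fun x => Rmax (a * cos x + b * sin x) 0
                    / ((Q * sin x ^ 2 + P * cos x ^ 2) * sqrt (Q * sin x ^ 2 + P * cos x ^ 2)))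
    0 (2 * PI) (2 * sqrt (P * b ^ 2 + Q * a ^ 2) / (P * Q)).
Proof.
  intros HP HQ. pose proof PI_RGT_0 as HPI.
  set (p x := Q * sin x ^ 2 + P * cos x ^ 2).
  set (f x := Rmax _ _ / _).
  set (g x := (a * cos x + b * sin x) / (p x * sqrt (p x))).
  set (F x := (a * sin x / P - b * cos x / Q) / sqrt (p x)).
  assert (Hpos : forall x, 0 < p x) by (intros; now apply quad_pos).
  assert (Hg : forall u v, u <= v -> is_RInt g u v (F v - F u)).
  { intros u v Huv. apply is_RInt_antiderivative; [exact Huv| |].
    - intros x. pose proof (Hpos x) as D. pose proof (sqrt_lt_R0 _ D) as D'.
      unfold F, g, p in *. auto_derive; change (sin x * (sin x * 1)) with (sin x ^ 2);
        change (cos x * (cos x * 1)) with (cos x ^ 2).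
      + repeat split; lra.
      + pose proof (sqrt_sqrt _ (Rlt_le _ _ D)) as S.
        set (w := sqrt _) in *.
        rewrite <- S.
        assert (W : w ^ 2 = Q * sin x ^ 2 + P * cos x ^ 2) by (rewrite <- S; ring).
        field_simplify_eq; [|repeat split; lra].
        replace (w ^ 5) with (w * w ^ 2 * w ^ 2) by ring.
        replace (w ^ 3) with (w * w ^ 2) by ring.
        replace (w ^ 4) with (w ^ 2 * w ^ 2) by ring.
        rewrite ?W, !cos_pow_SS. ring.
    - intros x. apply (ex_derive_continuous (V := R_NormedModule)).
      pose proof (Hpos x) as D. pose proof (sqrt_lt_R0 _ D) as D'.
      unfold g, p in *. auto_derive; change (sin x * (sin x * 1)) with (sin x ^ 2);
        change (cos x * (cos x * 1)) with (cos x ^ 2).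
      repeat split; [lra | nra]. }
  destruct (polar_zero a b) as (r & x0 & Hx0 & Ha & Hb).
  assert (L : forall x, a * cos x + b * sin x = r * sin (x - x0))
    by (intros; rewrite sin_minus, Ha, Hb; ring).
  assert (V : Rabs r * sqrt (p x0) / (P * Q) = sqrt (P * b ^ 2 + Q * a ^ 2) / (P * Q)).
  { f_equal. rewrite <- sqrt_Rsqr_abs, <- sqrt_mult_alt by apply Rle_0_sqr.
    f_equal. unfold p, Rsqr. rewrite Ha, Hb. ring. }
  pose proof (Hpos x0) as D. pose proof (sqrt_lt_R0 _ D) as D'.
  assert (F0 : F x0 = - r * sqrt (p x0) / (P * Q)).
  { unfold F. rewrite Ha, Hb.
    pose proof (sqrt_sqrt _ (Rlt_le _ _ D)) as S.
    transitivity (- r * p x0 / (P * Q * sqrt (p x0))).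
    - unfold p at 2. field. repeat split; lra.
    - rewrite <- S at 1. field. repeat split; lra. }
  assert (F1 : F (x0 + PI) = - F x0).
  { unfold F, p. rewrite neg_sin, neg_cos.
    replace (Q * (- sin x0) ^ 2 + P * (- cos x0) ^ 2) with (p x0) by (unfold p; ring).
    fold (p x0). field. repeat split; lra. }
  assert (F2 : F (2 * PI) = F 0).
  { unfold F, p. now rewrite sin_2PI, cos_2PI, sin_0, cos_0. }
  assert (on : forall u v, u <= v -> (forall x, u < x < v -> 0 <= r * sin (x - x0)) ->
    is_RInt f u v (F v - F u)).
  { intros u v Huv H. apply is_RInt_ext with g; [|now apply Hg].
    rewrite Rmin_left, Rmax_right by assumption. intros x Hx. unfold f, g.
    rewrite Rmax_left; [reflexivity|]. rewrite L. now apply H. }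
  assert (off : forall u v, u <= v -> (forall x, u < x < v -> r * sin (x - x0) <= 0) ->
    is_RInt f u v 0).
  { intros u v Huv H. apply is_RInt_zero_ext; [assumption|]. intros x Hx. unfold f.
    rewrite Rmax_right; [unfold Rdiv; ring|]. rewrite L. now apply H. }
  assert (s1 : forall x, 0 < x < x0 -> sin (x - x0) < 0)
    by (intros; apply (proj2 (sin_diff_sign x x0)); lra).
  assert (s2 : forall x, x0 < x < x0 + PI -> 0 < sin (x - x0))
    by (intros; apply (proj1 (sin_diff_sign x x0)); lra).
  assert (s3 : forall x, x0 + PI < x < 2 * PI -> sin (x - x0) < 0).
  { intros x Hx. replace (x - x0) with ((x - PI - x0) + PI) by ring. rewrite neg_sin.
    enough (0 < sin (x - PI - x0)) by lra. apply sin_gt_0; lra. }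
  replace (2 * sqrt _ / _) with (2 * (Rabs r * sqrt (p x0) / (P * Q)))
    by (rewrite V; unfold Rdiv; ring).
  destruct (Rle_lt_dec 0 r) as [Hr|Hr].
  - apply is_RInt_cut with x0 0 (F (x0 + PI) - F x0).
    + apply off; [lra|]. intros x Hx. specialize (s1 x Hx). nra.
    + apply is_RInt_cut with (x0 + PI) (F (x0 + PI) - F x0) 0.
      * apply on; [lra|]. intros x Hx. specialize (s2 x Hx). nra.
      * apply off; [lra|]. intros x Hx. specialize (s3 x Hx). nra.
      * ring.
    + rewrite F1, F0, Rabs_pos_eq by assumption. field. lra.
  - apply is_RInt_cut with x0 (F x0 - F 0) (F (2 * PI) - F (x0 + PI)).
    + apply on; [lra|]. intros x Hx. specialize (s1 x Hx). nra.
    + apply is_RInt_cut with (x0 + PI) 0 (F (2 * PI) - F (x0 + PI)).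
      * apply off; [lra|]. intros x Hx. specialize (s2 x Hx). nra.
      * apply on; [lra|]. intros x Hx. specialize (s3 x Hx). nra.
      * ring.
    + rewrite F1, F2, F0, Rabs_left by assumption. field. lra.
Qed.

(** * The potential of the hemisphere *)

(* [k] jumps at [0] when the gradient of the norm does, so a derivative test would not do:
   on a grid of step [u], the increments of [g] and [h] lie between the same multiples
   [u * k] taken at consecutive points, and the errors telescope. *)
Lemma eq_of_common_subgradient (g h k : R -> R) :
  (forall x y, (y - x) * k x <= g y - g x) ->
  (forall x y, (y - x) * k x <= h y - h x) ->
  g 0 = h 0 -> forall x, g x = h x.
Proof.
  intros Hg Hh H0 x.
  assert (step : forall u n, Rabs (g (INR n * u) - h (INR n * u)) <= u * (k (INR n * u) - k 0)).
  { intros u n. induction n as [|n IH].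
    - simpl INR. rewrite Rmult_0_l, H0, Rminus_diag, Rabs_R0. lra.
    - rewrite S_INR. replace ((INR n + 1) * u) with (INR n * u + u) by ring.
      set (z := INR n * u) in *.
      pose proof (Hg z (z + u)). pose proof (Hg (z + u) z).
      pose proof (Hh z (z + u)). pose proof (Hh (z + u) z).
      apply Rabs_le_between in IH. apply Rabs_le_between. lra. }
  apply Rminus_diag_uniq. destruct (Req_dec (g x - h x) 0) as [E|E]; [exact E|exfalso].
  apply Rabs_pos_lt in E. set (d := Rabs _) in *.
  (* The step [x / (n + 1)], of either sign, makes the grid end at [x]; hence [(n + 1) * d <= C] for
     every [n], against the Archimedean property. *)
  set (C := x * (k x - k 0)).
  destruct (INR_unbounded (C / d)) as (n & Hn).
  assert (Hn1 : 0 < INR (S n)) by apply lt_0_INR, Nat.lt_0_succ.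
  pose proof (step (x / INR (S n)) (S n)) as S1.
  replace (INR (S n) * (x / INR (S n))) with x in S1 by (field; lra).
  fold d in S1.
  assert (S2 : INR (S n) * d <= C).
  { apply Rmult_le_compat_l with (r := INR (S n)) in S1; [|lra].
    replace C with (INR (S n) * (x / INR (S n) * (k x - k 0))) by (unfold C; field; lra).
    exact S1. }
  rewrite S_INR in S2. apply Rmult_lt_compat_r with (r := d) in Hn; [|exact E].
  replace (C / d * d) with C in Hn by (field; lra). lra.
Qed.

(** This is Cauchy-Schwarz for the vectors [(sqrt A * x, sqrt B)] and [(sqrt A * y, sqrt B)]. *)
Lemma sqrt_subgradient A B x y : 0 <= A -> 0 <= B ->
  (y - x) * (A * x / sqrt (A * x ^ 2 + B)) <= sqrt (A * y ^ 2 + B) - sqrt (A * x ^ 2 + B).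
Proof.
  intros HA HB.
  assert (pos : forall z, 0 <= A * z ^ 2 + B)
    by (intros z; pose proof (pow2_ge_0 z); nra).
  pose proof (pos x) as Hx. pose proof (pos y) as Hy.
  destruct (Rle_lt_or_eq_dec _ _ Hx) as [Px|Ex].
  - pose proof (sqrt_lt_R0 _ Px) as Sx.
    assert (CS : A * x * y + B <= sqrt (A * x ^ 2 + B) * sqrt (A * y ^ 2 + B)).
    { rewrite <- sqrt_mult by assumption. apply Rle_trans with (Rabs (A * x * y + B));
        [apply Rle_abs|].
      rewrite <- sqrt_Rsqr_abs. apply sqrt_le_1_alt. unfold Rsqr.
      assert (0 <= A * B * (x - y) ^ 2) by
        (apply Rmult_le_pos; [now apply Rmult_le_pos | apply pow2_ge_0]). nra. }
    pose proof (sqrt_sqrt _ Hx) as SS.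
    apply Rmult_le_reg_l with (sqrt (A * x ^ 2 + B)); [exact Sx|].
    replace (sqrt (A * x ^ 2 + B) * ((y - x) * (A * x / sqrt (A * x ^ 2 + B))))
      with ((y - x) * (A * x)) by (field; lra).
    nra.
  (* Where the root vanishes, the slope is [0 / 0 = 0], a valid subgradient at a minimum. *)
  - rewrite <- Ex, sqrt_0. assert (AX : A * x = 0) by (pose proof (pow2_ge_0 x); nra).
    rewrite AX. pose proof (sqrt_pos (A * y ^ 2 + B)). unfold Rdiv. lra.
Qed.

Lemma Rmax_subgradient u d : d * (if Rle_dec 0 u then 1 else 0) <= Rmax (u + d) 0 - Rmax u 0.
Proof.
  destruct (Rle_dec 0 u) as [H|H].
  - rewrite (Rmax_left u) by assumption. pose proof (Rmax_l (u + d) 0). lra.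
  - rewrite (Rmax_right u) by lra. pose proof (Rmax_r (u + d) 0). lra.
Qed.

(** The potential density with [v = (a, b, c)] and [P], [Q], [q] for the inverse squares of the
    diagonal entries of [T]. *)
Definition cap P Q q a b c x y : R :=
  Rmax (sin x * cos y * a + sin x * sin y * b + cos x * c) 0
  / (P * (sin x * cos y) ^ 2 + Q * (sin x * sin y) ^ 2 + q * cos x ^ 2) ^ 2 * sin x.

(** * Closed form of the double integral of the positive part *)

Section Cap.
Variables P Q q : R.
Hypotheses (HP : 0 < P) (HQ : 0 < Q) (Hq : 0 < q).

Let p y := Q * sin y ^ 2 + P * cos y ^ 2.

Lemma cap_slice a b c x y : cap P Q q a b c x y
  = Rmax ((a * cos y + b * sin y) * sin x + c * cos x) 0
    * (sin x / (p y * sin x ^ 2 + q * cos x ^ 2) ^ 2).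
Proof.
  unfold cap.
  replace (sin x * cos y * a + _ + _)
    with ((a * cos y + b * sin y) * sin x + c * cos x) by ring.
  replace (P * _ + _ + _) with (p y * sin x ^ 2 + q * cos x ^ 2) by (unfold p; ring).
  unfold Rdiv; ring.
Qed.

Lemma cap_continuous a b c x y : continuity_2d_pt (cap P Q q a b c) x y.
Proof.
  pose proof (quad_pos (p y) q x (quad_pos Q P y HQ HP) Hq) as D.
  assert (s1 : continuity_2d_pt (fun x _ => sin x) x y)
    by (apply (continuity_1d_2d_pt_comp sin (fun x _ => x));
        [apply continuity_sin | apply continuity_2d_pt_id1]).
  assert (c1 : continuity_2d_pt (fun x _ => cos x) x y)
    by (apply (continuity_1d_2d_pt_comp cos (fun x _ => x));
        [apply continuity_cos | apply continuity_2d_pt_id1]).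
  assert (s2 : continuity_2d_pt (fun _ y => sin y) x y)
    by (apply (continuity_1d_2d_pt_comp sin (fun _ y => y));
        [apply continuity_sin | apply continuity_2d_pt_id2]).
  assert (c2 : continuity_2d_pt (fun _ y => cos y) x y)
    by (apply (continuity_1d_2d_pt_comp cos (fun _ y => y));
        [apply continuity_cos | apply continuity_2d_pt_id2]).
  unfold cap, Rdiv. simpl pow.
  apply continuity_2d_pt_mult; [apply continuity_2d_pt_mult|exact s1].
  - refine (continuity_1d_2d_pt_comp (fun u => Rmax u 0)
      (fun x y => sin x * cos y * a + sin x * sin y * b + cos x * c) x y _ _).
    + apply continuity_pt_filterlim.
      apply (continuous_ext (fun u => (u + Rabs u) / 2) (fun u => Rmax u 0)).
      * intros u. unfold Rmax. destruct (Rle_dec u 0).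
        -- rewrite Rabs_left1 by assumption. simpl. lra.
        -- rewrite Rabs_pos_eq by lra. simpl. lra.
      * apply (continuous_mult (fun u => u + Rabs u) (fun _ => / 2));
          [|apply continuous_const].
        apply (continuous_plus (V := R_NormedModule) (fun u => u) Rabs);
          [apply continuous_id | apply continuous_Rabs].
    + repeat (apply continuity_2d_pt_plus || apply continuity_2d_pt_mult
              || apply continuity_2d_pt_const || assumption).
  - apply continuity_2d_pt_inv.
    + repeat (apply continuity_2d_pt_plus || apply continuity_2d_pt_mult
              || apply continuity_2d_pt_const || assumption).
    + match goal with |- ?e <> 0 =>
        replace e with ((p y * sin x ^ 2 + q * cos x ^ 2) ^ 2) by (unfold p; ring) end.
      nra.
Qed.

Definition cap_integral a b c :=
  RInt (fun y => RInt (fun x => cap P Q q a b c x y) 0 PI) 0 (2 * PI).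

Lemma ex_RInt_cap a b c y : ex_RInt (fun x => cap P Q q a b c x y) 0 PI.
Proof.
  apply ex_RInt_everywhere_continuous, continuous_slice1, cap_continuous.
Qed.

Lemma ex_RInt_RInt_cap a b c :
  ex_RInt (fun y => RInt (fun x => cap P Q q a b c x y) 0 PI) 0 (2 * PI).
Proof.
  apply ex_RInt_everywhere_continuous, continuous_RInt_slice.
  - left; apply PI_RGT_0.
  - apply cap_continuous.
Qed.

Lemma cap_integral_equator a b :
  cap_integral a b 0 = PI * sqrt (q * (P * b ^ 2 + Q * a ^ 2)) / (P * Q * q).
Proof.
  pose proof PI_RGT_0 as HPI. pose proof (sqrt_lt_R0 _ Hq) as Sq.
  pose proof (sqrt_sqrt q (Rlt_le _ _ Hq)) as SSq.
  unfold cap_integral.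
  replace (PI * sqrt _ / _)
    with (PI / (2 * sqrt q) * (2 * sqrt (P * b ^ 2 + Q * a ^ 2) / (P * Q))).
  2:{ rewrite sqrt_mult_alt by lra. set (r := sqrt (_ + _)). rewrite <- SSq at 3.
      field. repeat split; lra. }
  apply is_RInt_unique.
  apply is_RInt_ext with (fun y => PI / (2 * sqrt q) * (Rmax (a * cos y + b * sin y) 0
                    / (p y * sqrt (p y)))).
  2:{ apply (is_RInt_scal (V := R_NormedModule)). now apply is_RInt_max_over_form. }
  intros y _. symmetry. apply is_RInt_unique.
  pose proof (quad_pos Q P y HQ HP) as Hp. fold (p y) in Hp.
  set (m := Rmax _ 0).
  pose proof (sqrt_lt_R0 _ Hp).
  replace (PI / (2 * sqrt q) * (m / (p y * sqrt (p y))))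
    with (m * (PI / (2 * p y * sqrt (p y * q))))
    by (rewrite sqrt_mult by lra; field; repeat split; lra).
  apply is_RInt_ext with (fun x => m * (sin x ^ 2 / (p y * sin x ^ 2 + q * cos x ^ 2) ^ 2)).
  - intros x. rewrite Rmin_left, Rmax_right by lra. intros Hx.
    rewrite cap_slice. rewrite Rmult_0_l, Rplus_0_r.
    (* Inside the interval [sin x] is positive, so it can be pulled out of the maximum. *)
    replace (Rmax _ 0) with (Rmax (sin x * (a * cos y + b * sin y)) (sin x * 0))
      by (f_equal; ring).
    rewrite RmaxRmult by (left; now apply sin_gt_0). fold m. unfold Rdiv.
    match goal with |- ?l = ?r => change (l = r :> R) end. ring.
  - apply (is_RInt_scal (V := R_NormedModule)). now apply is_RInt_sin2_over_quad2.
Qed.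

(** The denominator is a quadratic form in [(cos y, sin y)] of determinant [c ^ 2 * E], which is why
    [is_RInt_inv_form] is used with [de = Rabs c * sqrt E]. For [c = 0] the form degenerates, but
    the integrand and the value are zero. *)
Lemma is_RInt_cap_slope a b c :
  is_RInt (fun y => c * Rabs c / (2 * q * (p y * c ^ 2 + q * (a * cos y + b * sin y) ^ 2)))
    0 (2 * PI) (PI * c / (q * sqrt (P * Q * c ^ 2 + q * (P * b ^ 2 + Q * a ^ 2)))).
Proof.
  pose proof PI_RGT_0 as HPI.
  destruct (Req_dec c 0) as [->|Hc].
  - replace (PI * 0 / _) with 0 by (unfold Rdiv; ring).
    apply is_RInt_zero_ext; [lra|]. intros; unfold Rdiv; ring.
  - assert (Hc2 : 0 < c ^ 2) by (rewrite <- Rsqr_pow2; now apply Rsqr_pos_lt).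
    pose proof (Rabs_pos_lt c Hc) as Hac.
    assert (HB : 0 <= P * b ^ 2 + Q * a ^ 2)
      by (pose proof (pow2_ge_0 a); pose proof (pow2_ge_0 b); nra).
    assert (HE : 0 < P * Q * c ^ 2 + q * (P * b ^ 2 + Q * a ^ 2)).
    { apply Rplus_lt_le_0_compat; [repeat (assumption || apply Rmult_lt_0_compat) | nra]. }
    set (E := P * Q * c ^ 2 + _) in *. pose proof (sqrt_lt_R0 _ HE) as SE.
    pose proof (sqrt_sqrt E (Rlt_le _ _ HE)) as SSE.
    replace (PI * c / (q * sqrt E))
      with (c * Rabs c / (2 * q) * (2 * PI / (Rabs c * sqrt E)))
      by (field; repeat split; lra).
    apply is_RInt_ext with (fun y => c * Rabs c / (2 * q) *
      (/ ((P * c ^ 2 + q * a ^ 2) * cos y ^ 2 + 2 * (q * a * b) * cos y * sin y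
          + (Q * c ^ 2 + q * b ^ 2) * sin y ^ 2))).
    + intros y _.
      match goal with |- ?l = ?r => change (l = r :> R) end.
      replace (_ * cos y ^ 2 + _ + _)
        with (p y * c ^ 2 + q * (a * cos y + b * sin y) ^ 2) by (unfold p; ring).
      unfold Rdiv. rewrite (Rinv_mult (2 * q)). ring.
    + apply (is_RInt_scal (V := R_NormedModule)).
      apply is_RInt_inv_form; try nra.
      * replace ((Rabs c * sqrt E) ^ 2) with (Rabs c ^ 2 * (sqrt E * sqrt E)) by ring.
        rewrite SSE, pow2_abs. unfold E. ring.
      * apply sin_2PI.
Qed.

(** [Rmax_subgradient] with increment [(c' - c) * cos x], multiplied by a nonnegative weight, is
    integrated in [x] and then in [y]; monotonicity of the integral replaces differentiation under
    it. *)
Lemma cap_integral_subgradient a b c c' :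
  (c' - c) * (PI * c / (q * sqrt (P * Q * c ^ 2 + q * (P * b ^ 2 + Q * a ^ 2))))
  <= cap_integral a b c' - cap_integral a b c.
Proof.
  pose proof PI_RGT_0 as HPI.
  apply (is_RInt_le (fun y => (c' - c) * (c * Rabs c / (2 * q * (p y * c ^ 2 + q * (a * cos y + b * sin y) ^ 2))))
    (fun y => RInt (fun x => cap P Q q a b c' x y) 0 PI - RInt (fun x => cap P Q q a b c x y) 0 PI)
    0 (2 * PI)); [lra | | |].
  - apply (is_RInt_scal (V := R_NormedModule)), is_RInt_cap_slope.
  - apply (is_RInt_minus (V := R_NormedModule));
      apply (RInt_correct (V := R_CompleteNormedModule)), ex_RInt_RInt_cap.
  - intros y _. pose proof (quad_pos Q P y HQ HP) as Hp. fold (p y) in Hp.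
    set (u := a * cos y + b * sin y).
    apply (is_RInt_le (fun x => (c' - c) * (if Rle_dec 0 (u * sin x + c * cos x)
                    then sin x * cos x / (p y * sin x ^ 2 + q * cos x ^ 2) ^ 2 else 0))
      (fun x => cap P Q q a b c' x y - cap P Q q a b c x y) 0 PI); [lra | | |].
    + apply (is_RInt_scal (V := R_NormedModule)). now apply is_RInt_cap.
    + apply (is_RInt_minus (V := R_NormedModule));
        apply (RInt_correct (V := R_CompleteNormedModule)), ex_RInt_cap.
    + intros x Hx. rewrite !cap_slice. fold u.
      pose proof (quad_pos (p y) q x Hp Hq) as D.
      pose proof (Rmax_subgradient (u * sin x + c * cos x) ((c' - c) * cos x)) as S.
      replace (u * sin x + c * cos x + (c' - c) * cos x) with (u * sin x + c' * cos x)
        in S by ring.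
      assert (W : 0 <= sin x / (p y * sin x ^ 2 + q * cos x ^ 2) ^ 2).
      { apply Rmult_le_pos; [left; apply sin_gt_0; lra|].
        left. apply Rinv_0_lt_compat. nra. }
      apply Rmult_le_compat_r with (r := sin x / (p y * sin x ^ 2 + q * cos x ^ 2) ^ 2) in S;
        [|exact W].
      rewrite <- Rmult_minus_distr_r. eapply Rle_trans; [|exact S].
      right. destruct (Rle_dec _ _); unfold Rdiv; ring.
Qed.

(** As functions of [c], both sides admit the same subgradient, the formal derivative of the right
    side, and they agree on the equator [c = 0]. *)
Lemma cap_integral_eq a b c :
  cap_integral a b c
  = PI * sqrt (P * Q * c ^ 2 + q * (P * b ^ 2 + Q * a ^ 2)) / (P * Q * q).
Proof.
  pose proof PI_RGT_0 as HPI.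
  assert (HPQ : 0 < P * Q) by nra.
  assert (HB : 0 <= q * (P * b ^ 2 + Q * a ^ 2)).
  { pose proof (pow2_ge_0 a). pose proof (pow2_ge_0 b).
    apply Rmult_le_pos; [lra|]. nra. }
  apply (eq_of_common_subgradient (cap_integral a b)
    (fun c => PI * sqrt (P * Q * c ^ 2 + q * (P * b ^ 2 + Q * a ^ 2)) / (P * Q * q))
    (fun c => PI * c / (q * sqrt (P * Q * c ^ 2 + q * (P * b ^ 2 + Q * a ^ 2))))).
  - intros x y. apply cap_integral_subgradient.
  - intros x y.
    pose proof (sqrt_subgradient (P * Q) _ x y (Rlt_le _ _ HPQ) HB) as S.
    apply Rmult_le_compat_l with (r := PI / (P * Q * q)) in S.
    2:{ left. apply Rdiv_lt_0_compat; nra. }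
    rewrite Rmult_minus_distr_l in S. unfold Rdiv in *. rewrite !Rinv_mult in *.
    eapply Rle_trans; [|eapply Rle_trans; [exact S|]]; right.
    + generalize (/ sqrt (P * Q * x ^ 2 + q * (P * b ^ 2 + Q * a ^ 2))). intros r.
      field. repeat split; lra.
    + ring.
  - rewrite cap_integral_equator. do 3 f_equal. ring.
Qed.

Lemma is_RInt2_cap a b c : is_RInt2 (cap P Q q a b c) 0 PI 0 (2 * PI)
  (PI * sqrt (P * Q * c ^ 2 + q * (P * b ^ 2 + Q * a ^ 2)) / (P * Q * q)).
Proof.
  pose proof PI_RGT_0.
  rewrite <- cap_integral_eq. apply is_RInt2_continuous; [lra | lra |].
  apply cap_continuous.
Qed.

End Cap.

(** * From the potential to its gradient *)

Lemma norm3_sqr u : norm3 u ^ 2 = dot3 u u.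
Proof.
  unfold norm3, dot3. apply pow2_sqrt.
  pose proof (pow2_ge_0 (u 0%nat)). pose proof (pow2_ge_0 (u 1%nat)).
  pose proof (pow2_ge_0 (u 2%nat)). nra.
Qed.

Definition hemi_potential (t v : nat -> R) (x y : R) : R :=
  Rmax (dot3 (sph x y) v) 0 / quadTinv2 t (sph x y) ^ 2 * sin x.

Lemma is_RInt2_hemi_potential t v : t 0%nat * t 1%nat * t 2%nat <> 0 ->
  is_RInt2 (hemi_potential t v) 0 PI 0 (2 * PI)
    (PI * Rabs (t 0%nat * t 1%nat * t 2%nat) * norm3 (diagmul t v)).
Proof.
  intros ht.
  assert (n0 : t 0%nat <> 0) by (intros E; apply ht; rewrite E; ring).
  assert (n1 : t 1%nat <> 0) by (intros E; apply ht; rewrite E; ring).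
  assert (n2 : t 2%nat <> 0) by (intros E; apply ht; rewrite E; ring).
  assert (pos : forall z, z <> 0 -> 0 < / z ^ 2).
  { intros z Hz. apply Rinv_0_lt_compat. rewrite <- Rsqr_pow2. now apply Rsqr_pos_lt. }
  pose proof (is_RInt2_cap _ _ _ (pos _ n0) (pos _ n1) (pos _ n2)
    (v 0%nat) (v 1%nat) (v 2%nat)) as H.
  assert (D : 0 < Rabs (t 0%nat * t 1%nat * t 2%nat)) by now apply Rabs_pos_lt.
  match type of H with is_RInt2 _ _ _ _ _ ?l => replace l
    with (PI * Rabs (t 0%nat * t 1%nat * t 2%nat) * norm3 (diagmul t v)) in H end.
  - intros eps Heps. destruct (H eps Heps) as (dl & Hdl & H'). exists dl; split; [exact Hdl|].
    intros m n x y tx ty Px Py Ht. specialize (H' m n x y tx ty Px Py Ht).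
    erewrite sumN_ext; [exact H'|]. intros i _. apply sumN_ext. intros j _.
    do 2 f_equal. unfold hemi_potential, cap.
    replace (quadTinv2 t (sph (tx i j) (ty i j)))
      with (/ t 0%nat ^ 2 * (sin (tx i j) * cos (ty i j)) ^ 2
            + / t 1%nat ^ 2 * (sin (tx i j) * sin (ty i j)) ^ 2
            + / t 2%nat ^ 2 * cos (tx i j) ^ 2)
      by (unfold quadTinv2, sph; field; repeat split; assumption).
    reflexivity.
  (* With inverse squares as coefficients, the radicand is [|T v|^2 / (det T)^2] and the denominator
     is [/ (det T)^2], so one factor [|det T|] survives. *)
  - match goal with |- _ = PI * sqrt ?e / ?z =>
      replace e with (dot3 (diagmul t v) (diagmul t v) / (t 0%nat * t 1%nat * t 2%nat)²)
        by (unfold dot3, diagmul, Rsqr; field; repeat split; assumption);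
      replace z with (/ (t 0%nat * t 1%nat * t 2%nat)²)
        by (unfold Rsqr; field; repeat split; assumption) end.
    rewrite sqrt_div_alt by now apply Rsqr_pos_lt.
    rewrite sqrt_Rsqr_abs, (Rsqr_abs (_ * _)). unfold norm3, Rsqr. field. lra.
Qed.

Definition shift (v : nat -> R) (k : nat) (h : R) (i : nat) : R :=
  v i + (if Nat.eqb i k then h else 0).

Lemma dot3_shift n v k h : (k < 3)%nat -> dot3 n (shift v k h) = dot3 n v + h * n k.
Proof.
  intros Hk. unfold dot3, shift. destruct k as [|[|[|]]]; [simpl; ring ..| lia].
Qed.

(** Both signs of [h] are used: dividing by a positive [h] bounds the integrand from above, by a
    negative one from below. *)
Lemma hemi_integrand_le_slope t v k h x y :
  t 0%nat * t 1%nat * t 2%nat <> 0 -> (k < 3)%nat -> 0 <= x <= PI ->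
  h * hemi_integrand t v k x y
  <= hemi_potential t (shift v k h) x y - hemi_potential t v x y.
Proof.
  intros ht Hk Hx. unfold hemi_potential, hemi_integrand. rewrite dot3_shift by assumption.
  pose proof (Rmax_subgradient (dot3 (sph x y) v) (h * sph x y k)) as S.
  set (W := / quadTinv2 t (sph x y) ^ 2 * sin x).
  assert (HW : 0 <= W).
  { apply Rmult_le_pos; [|now apply sin_ge_0].
    pose proof (pow2_ge_0 (quadTinv2 t (sph x y))) as H.
    (* A vanishing denominator is covered by [/ 0 = 0]. *)
    destruct (Rle_lt_or_eq_dec _ _ H) as [H'|<-].
    - left; now apply Rinv_0_lt_compat.
    - rewrite Rinv_0. lra. }
  apply Rmult_le_compat_r with (r := W) in S; [|exact HW].
  replace (Rmax _ _ / _ * _ - _) with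
    ((Rmax (dot3 (sph x y) v + h * sph x y k) 0 - Rmax (dot3 (sph x y) v) 0) * W)
    by (unfold W, Rdiv; ring).
  eapply Rle_trans; [|exact S]. right. unfold W.
  destruct (Rle_dec _ _); unfold Rdiv; ring.
Qed.

Lemma derivable_norm3_shift t v k :
  0 < norm3 (diagmul t v) -> (k < 3)%nat ->
  derivable_pt_lim (fun h => norm3 (diagmul t (shift v k h))) 0
    (t k ^ 2 * v k / norm3 (diagmul t v)).
Proof.
  intros Hn Hk. apply is_derive_Reals.
  pose proof (norm3_sqr (diagmul t v)) as N.
  set (d := dot3 (diagmul t v) (diagmul t v)) in *.
  apply is_derive_ext with (fun h => sqrt (d + 2 * (t k ^ 2 * v k) * h + t k ^ 2 * h ^ 2)).
  { intros h. unfold norm3. f_equal. unfold d, dot3, diagmul, shift.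
    destruct k as [|[|[|]]]; [simpl; ring ..| lia]. }
  assert (Hd : 0 < d) by nra.
  auto_derive.
  - rewrite !Rmult_0_l, !Rmult_0_r, !Rplus_0_r. exact Hd.
  - unfold norm3. fold d. rewrite !Rmult_0_l, !Rmult_0_r, !Rplus_0_r.
    pose proof (sqrt_lt_R0 _ Hd). field. lra.
Qed.

Theorem theorem1 (t v : nat -> R)
  (ht : t 0%nat * t 1%nat * t 2%nat <> 0)
  (hv : ~ (v 0%nat = 0 /\ v 1%nat = 0 /\ v 2%nat = 0)) :
  forall k : nat, (k < 3)%nat ->
    is_RInt2 (hemi_integrand t v k) 0 PI 0 (2 * PI)
      (PI * Rabs (t 0%nat * t 1%nat * t 2%nat) * (t k ^ 2 * v k)
         / norm3 (diagmul t v)).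
Proof.
  intros k Hk.
  (* [T] is invertible and [v] nonzero, so [T v] avoids the origin, the one point where the norm is
     not differentiable. *)
  assert (Hn : 0 < norm3 (diagmul t v)).
  { destruct (Rle_lt_or_eq_dec _ _ (sqrt_pos (dot3 (diagmul t v) (diagmul t v))))
      as [H|H]; [exact H|exfalso].
    pose proof (norm3_sqr (diagmul t v)) as N. unfold norm3 in N. rewrite <- H in N.
    unfold dot3, diagmul in N.
    pose proof (pow2_ge_0 (t 0%nat * v 0%nat)). pose proof (pow2_ge_0 (t 1%nat * v 1%nat)).
    pose proof (pow2_ge_0 (t 2%nat * v 2%nat)).
    apply hv.
    assert (Z : forall a b, a <> 0 -> (a * b) ^ 2 = 0 -> b = 0).
    { intros a b Ha E. rewrite <- Rsqr_pow2 in E. apply Rsqr_0_uniq in E.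
      destruct (Rmult_integral _ _ E); [contradiction|assumption]. }
    repeat split; [apply (Z (t 0%nat)) | apply (Z (t 1%nat)) | apply (Z (t 2%nat))];
      try nra; intros E; apply ht; rewrite E; ring. }
  set (A := PI * Rabs (t 0%nat * t 1%nat * t 2%nat)).
  assert (HA : 0 < A) by (apply Rmult_lt_0_compat; [apply PI_RGT_0 | now apply Rabs_pos_lt]).
  set (G h := norm3 (diagmul t (shift v k h))).
  set (L := t k ^ 2 * v k / norm3 (diagmul t v)).
  replace (A * (t k ^ 2 * v k) / norm3 (diagmul t v)) with (A * L)
    by (unfold L, Rdiv; ring).
  apply is_RInt2_squeeze. intros eps Heps.
  (* The potential at the shifted vector integrates to [A * G h], so tolerance [eps / A] on the
     quotient of [G] becomes [eps] on the integrals. *)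
  destruct (derivable_norm3_shift t v k Hn Hk (eps / A) ltac:(now apply Rdiv_lt_0_compat))
    as (dl & Hdl). fold L in Hdl.
  assert (slope : forall h, h <> 0 -> Rabs h < dl -> exists l,
    is_RInt2 (fun x y => / h * (hemi_potential t (shift v k h) x y - hemi_potential t v x y))
      0 PI 0 (2 * PI) l /\ Rabs (l - A * L) < eps).
  { intros h Hh0 Hh. eexists. split.
    - apply is_RInt2_lin; now apply is_RInt2_hemi_potential.
    - specialize (Hdl h Hh0 Hh). rewrite Rplus_0_l in Hdl.
      assert (E : G 0 = norm3 (diagmul t v)).
      { unfold G, norm3. f_equal. unfold dot3, diagmul, shift.
        destruct k as [|[|[|]]]; [simpl; ring ..| lia]. }
      fold (G h) (G 0) in Hdl. fold A. fold (G h). rewrite E in Hdl.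
      replace (/ h * _ - _) with (A * ((G h - norm3 (diagmul t v)) / h - L))
        by (field; assumption).
      rewrite Rabs_mult, (Rabs_pos_eq A) by lra.
      apply Rmult_lt_compat_l with (r := A) in Hdl; [|exact HA].
      replace (A * (eps / A)) with eps in Hdl by (field; lra). exact Hdl. }
  pose proof (cond_pos dl) as Pdl. set (h := dl / 2).
  assert (Hh : 0 < h < dl) by (unfold h; lra).
  destruct (slope (- h)) as (l1 & R1 & B1); [lra | rewrite Rabs_Ropp, Rabs_pos_eq; lra |].
  destruct (slope h) as (l2 & R2 & B2); [lra | rewrite Rabs_pos_eq; lra |].
  apply Rabs_def2 in B1. apply Rabs_def2 in B2.
  do 4 eexists. split; [exact R1|]. split; [exact R2|]. split; [lra|]. split; [lra|].
  intros x y Hx _.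
  (* [U1] gives the upper bound; [U2], taken at [- h], gives the lower one after the sign change. *)
  pose proof (hemi_integrand_le_slope t v k h x y ht Hk Hx) as U1.
  pose proof (hemi_integrand_le_slope t v k (- h) x y ht Hk Hx) as U2.
  assert (Hi : 0 < / h) by (apply Rinv_0_lt_compat; lra).
  apply Rmult_le_compat_l with (r := / h) in U1; [|lra].
  apply Rmult_le_compat_l with (r := / h) in U2; [|lra].
  rewrite <- !Rmult_assoc in U1, U2. rewrite Rinv_opp.
  rewrite <- Ropp_mult_distr_r in U2.
  rewrite Rinv_l in U1, U2 by lra. lra.
Qed.
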